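(* For every positive integer $n$, $$\left\lfloor \zeta_n^*(2)^{-1}\right\rfloor=\begin{cases}-(2n^2-2n+1)-1 & \text{if } n\geq 2 \text{ is even},\\ 2n^2-2n+1 & \text{if } n\geq 1 \text{ is odd}.\end{cases}$$
   Context: For a positive integer $n$ and $s$ with $\Re(s)>0$, $\zeta_n^*(s)=\sum_{k=n}^{\infty}\frac{(-1)^{k+1}}{k^s}$ is the tail of the alternating Riemann zeta function. $\lfloor x\rfloor$ denotes the largest integer less than or equal to the real number $x$. *)

(* Defs.v *)
From mathcomp Require Import all_boot all_order all_algebra.
From mathcomp Require Import all_classical all_reals all_analysis.

Set Implicit Arguments.
Unset Strict Implicit.
Unset Printing Implicit Defensive.

Import Order.TTheory GRing.Theory Num.Theory.
Import numFieldNormedType.Exports.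

Local Open Scope ring_scope.

(* Restricted to real exponents; meaningful for 0 < n and 0 < s. For s <= 1 the
   series converges only conditionally, so its sum is the limit of the ordered
   partial sums. *)
Definition alt_zeta_tail (R : realType) (n : nat) (s : R) : R :=
  limn (fun m => \sum_(n <= k < m) ((-1) ^+ k.+1 / k%:R `^ s)).

(* Main.v *)
Require Import Defs.
From mathcomp Require Import all_boot all_order all_algebra.
From mathcomp Require Import all_classical all_reals all_analysis.
From mathcomp Require Import ring lra.

Set Implicit Arguments.
Unset Strict Implicit.
Unset Printing Implicit Defensive.

Import Order.TTheory GRing.Theory Num.Theory.
Import numFieldNormedType.Exports.

Local Open Scope ring_scope.

(** Let [T n] be the absolute value of the tail, so that [T n + T n.+1] is
    [1 / n ^ 2] and [T n] tends to [0]. The two elementary functions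
    [g x = 1 / (2 x ^ 2 - 2 x + 1)] and [h x = 1 / (2 x ^ 2 - 2 x + 2)] satisfy
    the same recurrence up to a small error, [g x + g (x + 1) - 1 / x ^ 2] and
    [1 / x ^ 2 - h x - h (x + 1)] being decreasing. Hence [g n - T n] and
    [T n - h n] strictly decrease along steps of length [2] and tend to [0],
    so both are positive, and [1 / T n] lies strictly between two consecutive
    integers. *)

(** Along [n + 2], [n + 4], ... the sequence decreases to its limit [0], so it is nonnegative there;
    the strict step from [n] to [n + 2] then makes [u n] positive. *)
Lemma gt0_of_decreasing_step2 (R : realType) (u : R^nat) (n : nat) :
  (forall k, (n <= k)%N -> u k.+2 < u k) ->
  (u @ \oo --> (0 : R))%classic -> 0 < u n.
Proof.
move=> udec u0; pose v m := u (n.+2 + m.*2)%N.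
have v0 : (v @ \oo --> (0 : R))%classic.
  apply: (cvg_comp (fun m => (n.+2 + m.*2)%N) u) u0.
  move=> P [N _ NP]; exists N => // m /= Nm; apply: NP => /=.
  by rewrite (leq_trans Nm)// -addnn addnA leq_addl.
have vdec : {homo v : i j / (i <= j)%N >-> j <= i}.
  apply/nonincreasing_seqP => m; rewrite /v doubleS !addnS.
  by apply/ltW/udec; rewrite !addSn (leq_trans (leq_addr m.*2 n))// !leqW.
have := nonincreasing_cvgn_ge vdec (cvgP _ v0) 0%N.
rewrite (cvg_lim _ v0)// /v addn0 => /le_lt_trans; apply.
exact: udec.
Qed.

(* The term [k = 0] is [0], because [0^-1 = 0]. *)
Lemma is_cvg_series_inv_sqr (R : realType) :
  cvgn (series (fun k : nat => (k%:R ^+ 2)^-1 : R)).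
Proof.
apply: nondecreasing_is_cvgn.
  by apply: nondecreasing_series => k _ _; rewrite invr_ge0 exprn_ge0.
(* Telescoping: [1 / (x + 1) ^ 2 <= 1 / x - 1 / (x + 1)], where [x = m + 1] is the last index summed
   at [m.+2]. *)
have bnd m : series (fun k : nat => (k%:R ^+ 2)^-1 : R) m.+2 <= 2 - m.+1%:R^-1.
  elim: m => [|m IH].
    rewrite /series /= !big_nat_recr//= big_geq// expr0n/= !invr0 !add0r expr1n.
    by rewrite invr1; lra.
  rewrite /series /= big_nat_recr//=; apply: le_trans (lerD IH (lexx _)) _.
  rewrite -subr_ge0 -(natr1 m.+1).
  have : (0 : R) < m.+1%:R by rewrite ltr0n.
  set x : R := m.+1%:R => x0.
  have -> : 2 - (x + 1)^-1 - (2 - x^-1 + ((x + 1) ^+ 2)^-1)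
            = (x * (x + 1) ^+ 2)^-1 :> R.
    by field; lra.
  by rewrite invr_ge0 mulr_ge0 ?exprn_ge0; lra.
exists 2 => _ [m _ <-].
apply: (@le_trans _ _ (series (fun k : nat => (k%:R ^+ 2)^-1 : R) m.+2)).
  apply: (nondecreasing_series (P := predT)); last by rewrite !leqW.
  by move=> k _ _; rewrite invr_ge0 exprn_ge0.
by apply: le_trans (bnd m) _; rewrite gerBl invr_ge0.
Qed.

Section tail_at_two.
Variable R : realType.

Let term (k : nat) : R := (-1) ^+ k.+1 / k%:R ^+ 2.

Let T (n : nat) : R := (-1) ^+ n.+1 * alt_zeta_tail n (2 : R).

Lemma is_cvg_series_alt_inv_sqr : cvgn (series term).
Proof.
apply: normed_cvg.
have -> : [normed series term]%classic
          = series (fun k : nat => (k%:R ^+ 2)^-1 : R).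
  congr series; apply/funext => k /=.
  by rewrite normrM normfV normrX normrN1 expr1n mul1r ger0_norm// exprn_ge0.
exact: is_cvg_series_inv_sqr.
Qed.

(** In this form both the recurrence for [T] and its convergence to [0] can be read off. *)
Lemma alt_zeta_tail_two n :
  alt_zeta_tail n (2 : R) = limn (series term) - series term n.
Proof.
rewrite /alt_zeta_tail; apply/cvg_lim => //.
apply: (@cvg_trans _ ((fun m => series term m - series term n) @ \oo)%classic).
  apply: near_eq_cvg; near=> m.
  have nm : (n <= m)%N by near: m; exact: nbhs_infty_ge.
  rewrite /series /= (big_cat_nat (leq0n n) nm)//= addrAC subrr add0r.
  by apply: eq_bigr => k _; rewrite powR_mulrn.
by apply: cvgB; [exact: is_cvg_series_alt_inv_sqr | exact: cvg_cst].
Unshelve. all: end_near. Qed.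

Lemma abs_tail_rec n : T n = (n%:R ^+ 2)^-1 - T n.+1.
Proof.
rewrite /T !alt_zeta_tail_two seriesSr; move: (limn _) (series term n) => a b.
rewrite /term !exprS; set s := (-1) ^+ n; set q := _^-1.
have ss : s * s = 1 by rewrite /s -expr2 sqrr_sign.
by ring: ss.
Qed.

Lemma abs_tail_cvg0 : (T @ \oo --> (0 : R))%classic.
Proof.
apply/norm_cvg0P.
have absT n : `|T n| = `|limn (series term) - series term n|.
  by rewrite /T normrM normrX normrN1 expr1n mul1r alt_zeta_tail_two.
rewrite (eq_cvg _ _ absT).
apply/norm_cvg0P; rewrite -(subrr (limn (series term))).
by apply: cvgB; [exact: cvg_cst | exact: is_cvg_series_alt_inv_sqr].
Qed.

Lemma inv_quadratic_cvg0 (c : R) : 1 <= c ->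
  ((fun n : nat => (2 * n%:R ^+ 2 - 2 * n%:R + c)^-1) @ \oo --> (0 : R))%classic.
Proof.
move=> c1.
(* The shift ensures [x >= 1], where [2 x ^ 2 - 2 x + c - x >= (2 x - 1) (x - 1) >= 0], so the
   harmonic sequence dominates. *)
rewrite -(cvg_shiftS (fun n : nat => (2 * n%:R ^+ 2 - 2 * n%:R + c)^-1)).
apply: (squeeze_cvgr _ (cvg_cst 0) cvg_harmonic).
apply: nearW => n /=.
have : (1 : R) <= n.+1%:R by rewrite ler1n.
move: (n.+1%:R : R) => x x1; apply/andP; split.
  by rewrite invr_ge0; nra.
by rewrite lef_pV2 ?posrE; nra.
Qed.

Lemma abs_tail_lt n : (0 < n)%N -> T n < (2 * n%:R ^+ 2 - 2 * n%:R + 1)^-1.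
Proof.
move=> n0; rewrite -subr_gt0.
apply: (gt0_of_decreasing_step2
  (u := fun n => (2 * n%:R ^+ 2 - 2 * n%:R + 1)^-1 - T n)); last first.
  rewrite -(subrr 0); apply: cvgB; last exact: abs_tail_cvg0.
  exact: inv_quadratic_cvg0.
(* Two uses of the recurrence leave [T k.+2] on both sides; it cancels, and the gap is a rational
   function of [k]. *)
move=> k nk; rewrite (abs_tail_rec k) (abs_tail_rec k.+1) -subr_gt0.
move: (T _) => t; rewrite -(natr1 k.+1) -(natr1 k).
have : (1 : R) <= k%:R by rewrite ler1n (leq_trans n0 nk).
move: (k%:R : R) => x x1.
set d := (X in 0 < X).
(* The last factor is [2 y ^ 2 - 2 y + 1] at [y = x + 2]. All factors are positive for [x >= 1]; in
   particular [4 x ^ 2 + 4 x - 5 >= 3]. *)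
have -> : d = (2 * x + 1) * (4 * x ^+ 2 + 4 * x - 5) / (x ^+ 2 * (x + 1) ^+ 2
    * (2 * x ^+ 2 - 2 * x + 1) * (2 * x ^+ 2 + 6 * x + 5)).
  by rewrite /d; field; do ?[apply/andP; split]; nra.
by rewrite divr_gt0// ?mulr_gt0 ?exprn_gt0//; nra.
Qed.

Lemma abs_tail_gt n : (0 < n)%N -> (2 * n%:R ^+ 2 - 2 * n%:R + 2)^-1 < T n.
Proof.
move=> n0; rewrite -subr_gt0.
apply: (gt0_of_decreasing_step2
  (u := fun n => T n - (2 * n%:R ^+ 2 - 2 * n%:R + 2)^-1)); last first.
  rewrite -(subrr 0); apply: cvgB; first exact: abs_tail_cvg0.
  by apply: inv_quadratic_cvg0; lra.
move=> k nk; rewrite (abs_tail_rec k) (abs_tail_rec k.+1) -subr_gt0.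
move: (T _) => t; rewrite -(natr1 k.+1) -(natr1 k).
have : (1 : R) <= k%:R by rewrite ler1n (leq_trans n0 nk).
move: (k%:R : R) => x x1.
set d := (X in 0 < X).
(* Here too the last factor is the quadratic [2 y ^ 2 - 2 y + 2] at [y = x + 2]. *)
have -> : d = 12 * (2 * x + 1) / (x ^+ 2 * (x + 1) ^+ 2
    * (2 * x ^+ 2 - 2 * x + 2) * (2 * x ^+ 2 + 6 * x + 6)).
  by rewrite /d; field; do ?[apply/andP; split]; nra.
by rewrite divr_gt0// ?mulr_gt0 ?exprn_gt0//; nra.
Qed.

Lemma inv_abs_tail_bounds n : (0 < n)%N ->
  2 * n%:R ^+ 2 - 2 * n%:R + 1 < (T n)^-1 < 2 * n%:R ^+ 2 - 2 * n%:R + 2.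
Proof.
move=> n0; have n1 : (1 : R) <= n%:R by rewrite ler1n.
have A0 : 0 < 2 * n%:R ^+ 2 - 2 * n%:R + 1 :> R by nra.
have lo := abs_tail_gt n0; have hi := abs_tail_lt n0.
have T0 : 0 < T n by apply: lt_trans lo; rewrite invr_gt0; lra.
apply/andP; split.
  by rewrite -[ltLHS]invrK ltf_pV2 ?posrE ?invr_gt0.
by rewrite -[ltRHS]invrK ltf_pV2 ?posrE ?invr_gt0//; lra.
Qed.

End tail_at_two.

Theorem theorem1p2 (R : realType) (n : nat) (hn : (0 < n)%N) :
  Num.floor (alt_zeta_tail n (2 : R))^-1 =
    if odd n then 2 * n%:Z ^+ 2 - 2 * n%:Z + 1
    else - (2 * n%:Z ^+ 2 - 2 * n%:Z + 1) - 1.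
Proof.
have /andP[lo hi] := inv_abs_tail_bounds R hn.
have sgnV : ((-1) ^+ n.+1 * alt_zeta_tail n (2 : R))^-1
            = (-1) ^+ n.+1 * (alt_zeta_tail n (2 : R))^-1.
  by rewrite invfM -exprVn invrN1.
move: lo hi; rewrite sgnV -signr_odd /=.
(* With [a = 2 n ^ 2 - 2 n + 1], the inverse of the tail lies in [(a, a + 1)] for odd [n]; for even
   [n] the sign reflects this to [(- a - 1, - a)], whence the extra [- 1]. *)
by case: (odd n) => /= lo hi; apply: floor_def;
  rewrite ?(rmorphD, rmorphB, rmorphN, rmorphM, rmorphXn)/=;
  apply/andP; split; lra.
Qed.
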